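(* Let $V$ be a poset, $W\subset V$ (with the induced partial order), and let $V$ and $W$ be equipped with topologies (the topology on $W$ need not be the one induced from $V$) such that both become ordered topological spaces. Let $D\subset V$ and let $\underline S\colon D\to\mathcal P(D)$ and $S\colon D\to\mathcal P(D\cap W)$ be multifunctions such that: (i) $D$ is an upper semilattice and is compact in $V$; (ii) all values of $S$ are compact and closed in $W$; (iii) $\underline S$ is permanent upward, all its values are directed upward, and for all $v\in D$ it holds $S(v)\subset\underline S(v)$ and $\underline S(v)\leq^\ast S(v)$; (iv) there is $\underline u\in D$ such that $\{\underline u\}\leq^\ast\underline S(\underline u)$. Then $S$ has a greatest fixed point $u^\ast$ (i.e. the set $\{v\in D\cap W: v\in S(v)\}$ has a greatest element $u^\ast$), and it holds $\underline u\leq u^\ast$.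
   Context: A poset is a set with a partial order $\leq$; subsets carry the induced order. $\mathcal P(X)$ is the power set of $X$ (including $\emptyset$). For subsets $A,B$ of a poset, $A\leq^\ast B$ means: for all $a\in A$ there is $b\in B$ with $a\leq b$. An ordered topological space is a poset $X$ with a topology such that for all $a,b\in X$ the sets $\{c\in X:a\leq c\}$, $\{c\in X:c\leq b\}$ and $\{c\in X: a\leq c\leq b\}$ are closed. An upper semilattice is a poset in which $\sup\{a,b\}$ exists for all elements $a,b$. A multifunction $T\colon D\to\mathcal P(D)$ is permanent upward if $a\leq b$ in $D$ implies $T(a)\subset T(b)$. A subset $M$ of a poset is directed upward if for all $a,b\in M$ there is $c\in M$ with $a\leq c$ and $b\leq c$. *)

(* Defs.v *)
From HB Require Import structures.
From mathcomp Require Import all_boot all_order.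
From mathcomp Require Import all_classical all_analysis.

Set Implicit Arguments.
Unset Strict Implicit.
Unset Printing Implicit Defensive.

Local Open Scope order_scope.
Local Open Scope classical_set_scope.

(* Unlike the library's [orderTopologicalType], the order need not be total and
   the topology need not be generated by intervals. *)
HB.mixin Record POrderedTopological_isOrderedSpace d (X : Type)
    & POrderedTopological d X := {
  closed_upray : forall a : X, closed [set c : X | a <= c];
  closed_downray : forall b : X, closed [set c : X | c <= b];
  closed_segment : forall a b : X, closed [set c : X | a <= c <= b]
}.

#[short(type="orderedSpaceType")]
HB.structure Definition OrderedSpace d :=
  { X of POrderedTopological d X & POrderedTopological_isOrderedSpace d X }.

(* A subset [W] of the poset [V], seen as a type with the order induced from [V]
   ([SubPOrder] makes [val] an order embedding with image [W]) and with its own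
   ordered-space topology.  No relation with a topology of [V] is required; this
   is why the sigma type [set_type W], which the library equips with the initial
   topology of the inclusion, is not used. *)
#[short(type="orderedSubSpaceType")]
HB.structure Definition OrderedSubSpace d (V : porderType d) (W : set V) d' :=
  { U of @Order.SubPOrder d V (fun x => x \in W) d' U & OrderedSpace d' U }.

Section PosetNotions.
Context {d : Order.disp_t} {V : porderType d}.
Implicit Types (A B D M : set V) (T : V -> set V).

Definition le_star A B := forall a, A a -> exists2 b, B b & a <= b.

Definition directed_upward M :=
  forall a b, M a -> M b -> exists c, [/\ M c, a <= c & b <= c].

(* The supremum is computed in [D] with the induced order: it lies in [D] and is
   only compared with the upper bounds that lie in [D]. *)
Definition is_sup_in D A s :=
  [/\ D s, ubound A s & forall t, D t -> ubound A t -> s <= t].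

Definition upper_semilattice D :=
  forall a b, D a -> D b -> exists s, is_sup_in D [set a; b] s.

(* Multifunctions on [D] are total functions on [V] of which only the values at
   points of [D] matter. *)
Definition permanent_upward D T :=
  forall a b, D a -> D b -> a <= b -> T a `<=` T b.

Definition greatest_element A x := A x /\ ubound A x.

End PosetNotions.

(* Main.v *)
(* Each nonempty value [S v] is directed, because [Sl v] is directed and
   [Sl v <=* S v]; being compact in [W], it has a greatest element [g v], which
   is then also the greatest element of [Sl v].  Since [Sl] is permanent upward,
   [g] is increasing.  The set [E] of the [v] in [D] with [v <= g v] is therefore
   closed under binary suprema, hence directed, so compactness of [D] gives it
   a supremum [u*], and as for Tarski's theorem [u*] lies in [E] and is fixed
   by [g]. *)
Require Import Defs.
From HB Require Import structures.
From mathcomp Require Import all_boot all_order.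
From mathcomp Require Import all_classical all_analysis.

Import Order.TTheory.

Local Open Scope order_scope.
Local Open Scope classical_set_scope.

(** The tails of [M] generate a proper filter, which clusters at some [s] in [K]. Closed up-rays
    make [s] an upper bound of [M]; closed down-rays put it below every other one in [K]. *)
Lemma directed_compact_sup (d : Order.disp_t) (X : orderedSpaceType d)
    (K M : set X) :
  compact K -> M `<=` K -> M !=set0 -> directed_upward M ->
  exists s, is_sup_in K M s.
Proof.
move=> cK MK [m0 Mm0] dirM.
pose F := filter_from M (fun a => M `&` [set x | a <= x]).
have FF : ProperFilter F.
  apply: filter_from_proper; last by move=> a Ma; exists a; split => /=.
  apply: filter_from_filter; first by exists m0.
  move=> a b Ma Mb; have [c [Mc ac bc]] := dirM _ _ Ma Mb.
  by exists c => // x [Mx /= cx]; split; split => //=;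
    [exact: le_trans cx | exact: le_trans cx].
have FK : F K by exists m0 => // x [/MK].
have [s [Ks]] := cK F FF FK; rewrite clusterE => clFs.
exists s; split=> // [a Ma|t Kt tM].
- by apply: (closed_upray a); apply: clFs; exists a => // x [].
- by apply: (closed_downray t); apply: clFs; exists m0 => // x [/tM].
Qed.

Theorem theorem2p11 (d d' : Order.disp_t) (V : orderedSpaceType d)
    (W : set V) (sW : orderedSubSpaceType W d')
    (D : set V) (Sl S : V -> set V)
    (Sl_sub : forall v, D v -> Sl v `<=` D)
    (S_sub : forall v, D v -> S v `<=` D `&` W)
    (D_semilattice : upper_semilattice D)
    (D_compact : compact D)
    (S_compact_closed : forall v, D v ->
       compact ((val : sW -> V) @^-1` S v) /\
       closed ((val : sW -> V) @^-1` S v))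
    (Sl_permanent : permanent_upward D Sl)
    (Sl_directed : forall v, D v -> directed_upward (Sl v))
    (S_Sl : forall v, D v -> S v `<=` Sl v /\ le_star (Sl v) (S v))
    (ul : V) (D_ul : D ul) (ul_Sl : le_star [set ul] (Sl ul)) :
  exists ustar : V,
    greatest_element [set v | (D `&` W) v /\ S v v] ustar /\ ul <= ustar.
Proof.
have has_max v : D v -> Sl v !=set0 -> exists g, S v g /\ ubound (Sl v) g.
  move=> Dv [w0 Slw0]; have [SSl SlS] := S_Sl _ Dv.
  have Sval x : S v x -> exists2 y : sW, val y = x & S v (val y).
    move=> Sx; have [_ /mem_set Wx] := S_sub _ Dv _ Sx.
    by exists (Sub x Wx); rewrite SubK.
  have [cS _] := S_compact_closed _ Dv.
  (* With [K = M], the supremum belongs to the set itself, so it is a greatest element. *)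
  have [||s [Ss sS _]] := directed_compact_sup _ _ _ _ cS (@subset_refl _ _).
  - have [b Sb _] := SlS _ Slw0.
    by have [y _ Sy] := Sval _ Sb; exists y.
  - move=> a b Sa Sb.
    have [c [Slc ac bc]] := Sl_directed _ Dv _ _ (SSl _ Sa) (SSl _ Sb).
    have [e Se ce] := SlS _ Slc.
    have [y ye Sy] := Sval _ Se.
    by exists y; split=> //; rewrite -Order.le_val ye; exact: le_trans ce.
  - exists (val s); split=> // w Slw.
    have [b Sb wb] := SlS _ Slw.
    have [y yb Sy] := Sval _ Sb.
    by apply: le_trans wb _; rewrite -yb Order.le_val; exact: sS.
(* By [has_max], this is [v <= g v], stated without choosing [g v] or assuming [Sl v] nonempty. *)
pose E := [set v | D v /\ exists2 w, Sl v w & v <= w].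
(* The greatest element of [Sl s] bounds every [Sl x] with [x] in [M], hence bounds [M]; it lies in
   [D], so it is above [s]. This serves both for pairs and for [M = E]. *)
have E_sup M s : M `<=` E -> M !=set0 -> is_sup_in D M s -> E s.
  move=> ME [m Mm] [Ds sM s_min]; split=> //.
  have Sl_s x w : M x -> Sl x w -> Sl s w.
    by move=> Mx; apply: Sl_permanent => //; [case: (ME _ Mx) | exact: sM].
  have [_ [w Slw _]] := ME _ Mm.
  have [|g [Sg gmax]] := has_max _ Ds; first by exists w; exact: Sl_s Slw.
  exists g; first by have [SSl _] := S_Sl _ Ds; exact: SSl.
  apply: s_min; first by have [] := S_sub _ Ds _ Sg.
  move=> x Mx; have [_ [z Slz xz]] := ME _ Mx.
  by apply: le_trans xz _; apply: gmax; exact: Sl_s Slz.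
have E_ul : E ul by split=> //; have [//|b Slb ulb] := ul_Sl ul; exists b.
have ED : E `<=` D by move=> v [].
have E0 : E !=set0 by exists ul.
have E_dir : directed_upward E.
  move=> a b Ea Eb.
  have [s sup_s] := D_semilattice _ _ (ED _ Ea) (ED _ Eb).
  have [_ s_ub _] := sup_s.
  exists s; split; [| by apply: s_ub; left | by apply: s_ub; right].
  apply: (E_sup _ _ _ _ sup_s); last by exists a; left.
  by move=> x [->|->].
have [u sup_u] := directed_compact_sup _ _ _ _ D_compact ED E0 E_dir.
have [Du uE _] := sup_u.
have [_ [w Slw uw]] := E_sup _ _ (@subset_refl _ E) E0 sup_u.
have [|g [Sg gmax]] := has_max _ Du; first by exists w.
have ug : u <= g by exact: le_trans uw (gmax _ Slw).
have [SSl _] := S_Sl _ Du.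
have DWg := S_sub _ Du _ Sg; have [Dg _] := DWg.
(* From [u <= g], [Sl u] is contained in [Sl g], so [g] is its own witness. *)
have Eg : E g.
  by split=> //; exists g => //; apply: Sl_permanent ug _ (SSl _ Sg).
have gu : g = u by apply/le_anti; rewrite ug uE.
rewrite {}gu in DWg Sg.
exists u; split; last exact: uE.
(* Any fixed point of [S] lies in [E], again as its own witness. *)
split=> // v [[Dv _] Sv]; apply: uE; split=> //.
by exists v => //; have [SSlv _] := S_Sl _ Dv; exact: SSlv.
Qed.
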